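(* Let $n\ge2$, $r\le -1$ and $p\in(0,1)$, and for each integer $m\ge2$ let $U_1^m,\dots,U_n^m$ be negatively upper orthant dependent discrete uniform random variables on $\{1/m,2/m,\dots,m/m\}$. There exists a sequence $\{p_m: m\ge2\}$ such that $$\mathbb P\left(M_r(U_1^m,\dots,U_n^m)\le p\right)\ge p_m \text{ for all } m\ge 2,\qquad\text{and}\qquad p_m\to p\ \text{ as } m\to\infty.$$ Moreover, one can take $$p_m=p-\frac{p^{1-r}}{m}\left(\left(np^r-(n-1)\left(\frac{m+1}{m}\right)^r\right)^{1/r}-\frac1m\right)^{r-1}$$ if $m>n^{-1/r}p^{-1}$, and $p_m=0$ otherwise.
   Context: $M_r$ is the symmetric $r$-mean: $M_r(u_1,\dots,u_n)=\left(\frac1n\sum_{i=1}^nu_i^r\right)^{1/r}$ for $(u_1,\dots,u_n)\in(0,\infty)^n$. Each $U_i^m$ takes each of the values $1/m,2/m,\dots,m/m$ with probability $1/m$. Random variables $X_1,\dots,X_n$ are negatively upper orthant dependent (NUOD) if for all $x_1,\dots,x_n\in\mathbb R$, $\mathbb P(X_1>x_1,\dots,X_n>x_n)\le\prod_{i=1}^n\mathbb P(X_i>x_i)$. *)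

(* Defs.v *)
From HB Require Import structures.
From mathcomp Require Import all_boot all_order all_algebra.
From mathcomp Require Import all_classical all_reals all_analysis.

Set Implicit Arguments.
Unset Strict Implicit.
Unset Printing Implicit Defensive.

Import Order.TTheory GRing.Theory Num.Theory.
Import numFieldNormedType.Exports.

Local Open Scope classical_set_scope.
Local Open Scope ring_scope.

(* Only meaningful on positive arguments, where [powR] is the usual power:
   [powR] of a negative number is 1. *)
Definition symmetric_mean (R : realType) (n : nat) (r : R) (u : 'I_n -> R) : R :=
  ((\sum_(i < n) u i `^ r) / n%:R) `^ r^-1.

Definition NUOD (R : realType) (d : measure_display) (T : measurableType d)
    (P : probability T R) (n : nat) (X : 'I_n -> {RV P >-> R}) : Prop :=
  forall x : 'I_n -> R,
    (P [set w | forall i, (x i < X i w)%R] <=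
     \prod_(i < n) P [set w | (x i < X i w)%R])%E.

(* For m > 0 these m masses sum to 1, so they determine the law of X. *)
Definition discrete_uniform (R : realType) (d : measure_display)
    (T : measurableType d) (P : probability T R) (m : nat) (X : {RV P >-> R}) :
    Prop :=
  forall k : nat, (1 <= k <= m)%N ->
    P [set w | X w = k%:R / m%:R] = (m%:R^-1)%:E.

Definition lower_bound_seq (R : realType) (n : nat) (r p : R) (m : nat) : R :=
  if n%:R `^ (- r^-1) * p^-1 < m%:R then
    p - p `^ (1 - r) / m%:R *
        ((n%:R * p `^ r - (n%:R - 1) * ((m%:R + 1) / m%:R) `^ r) `^ r^-1
          - m%:R^-1) `^ (r - 1)
  else 0.

(* Main.v *)
Require Import Defs.
From HB Require Import structures.
From mathcomp Require Import all_boot all_order all_algebra.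
From mathcomp Require Import all_classical all_reals all_analysis measurable_realfun.
From mathcomp Require Import ring lra.

Set Implicit Arguments.
Unset Strict Implicit.
Unset Printing Implicit Defensive.

Import Order.TTheory GRing.Theory Num.Theory.
Import numFieldNormedType.Exports.

Local Open Scope classical_set_scope.
Local Open Scope ring_scope.

(** The mean can exceed [p] only if every coordinate exceeds one common threshold
[a], which confines the bad event to a single upper orthant. Indeed, since [r < 0] and the
coordinates lie in (0, 1], each [u_i `^ r] is at least 1, so a mean above [p],
that is [\sum_i u_i `^ r < n * p `^ r], forces
[u_i `^ r < n * p `^ r - (n - 1)] for each single [i], that is [u_i > a] with
[a = box_edge n r p]. The dependence hypothesis bounds the probability of that
orthant by the product of the marginal tails, and a uniform law on the grid of
mesh [1 / m] has tail at most [1 - (a - 1 / m)]. Hence the probability that the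
mean is at most [p] is at least [1 - (1 - x) ^+ n] with [x = a - 1 / m]
(lemma [mean_le_prob_ge]).

The rest is real analysis. Let [q x] be the [r]-mean of the vector
[(x, 1, ..., 1)] ([corner_mean]); by the choice of [a], [q a = p]. Two facts on
[q] suffice.
- [q x <= 1 - (1 - x) ^+ n]: power means increase with the exponent and
  [r <= -1], so [r] may be replaced by [-1], and for the harmonic mean the
  claim reduces to the Bernoulli inequality
  ([corner_mean_le_one_sub_exp]).
- [q (a - 1 / m)] falls short of [q a = p] by at most
  [p `^ (1 - r) / m * (a - 1 / m) `^ (r - 1)], by convexity of [y `^ r]
  ([corner_mean_drop]).
The sequence of the theorem has the same form with a number [rounded_edge] that
is at most [a] in place of [a], which can only lower it. It tends to [p] because
[rounded_edge] is at least [n `^ r^-1 * p], a positive number that does not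
depend on [m]. *)

(** * Bernoulli inequalities and tangent lines for real powers *)

Lemma ln_le_subr1 (R : realType) (z : R) : 0 < z -> ln z <= z - 1.
Proof.
move=> z0; have {1}-> : z = 1 + (z - 1) by rewrite addrC subrK.
by apply: le_ln1Dx; lra.
Qed.

(** Both cases of the next lemma come from this bound, which is
[1 + t <= expR t] at [t = s * ln z]. *)
Lemma powR_bernoulli_ln (R : realType) (s z : R) :
  0 < z -> 1 + s * ln z <= z `^ s.
Proof. by move=> z0; rewrite -ln_powR -{2}(lnK (powR_gt0 s z0)) expR_ge1Dx. Qed.

(** For [s <= 0] bound [ln z] above by [z - 1]. For [1 <= s] factor [z] out and
use the exponent [s - 1]; the bound [z - 1 <= z * ln z] needed then is the
previous one at [z^-1]. *)
Lemma powR_bernoulli (R : realType) (s z : R) :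
  0 < z -> s <= 0 \/ 1 <= s -> 1 + s * (z - 1) <= z `^ s.
Proof.
move=> z0 [s0|s1].
  apply: le_trans (powR_bernoulli_ln s z0).
  by rewrite lerD2l ler_wnM2l// ln_le_subr1.
have zlnz : z - 1 <= z * ln z.
  have: ln z^-1 <= z^-1 - 1 by rewrite ln_le_subr1// invr_gt0.
  rewrite lnV ?posrE// => /(ler_wpM2l (ltW z0)).
  by rewrite mulrBr mulfV ?gt_eqF//; lra.
rewrite (_ : z `^ s = z * z `^ (s - 1)); last first.
  rewrite -{2}(powRr1 (ltW z0)) -powRD ?subrKC//.
  by rewrite (gt_eqF z0) implybT.
have := ler_wpM2l (ltW z0) (powR_bernoulli_ln (s - 1) z0).
nra.
Qed.

(** Convexity of the [s]-th power: the Bernoulli inequality at [y / x], rescaled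
by [x `^ s]. *)
Lemma powR_tangent (R : realType) (s x y : R) : 0 < x -> 0 < y ->
  s <= 0 \/ 1 <= s -> x `^ s + s * x `^ (s - 1) * (y - x) <= y `^ s.
Proof.
move=> x0 y0 hs.
have -> : y `^ s = x `^ s * (y / x) `^ s.
  by rewrite -powRM ?ltW ?divr_gt0// mulrCA mulfV ?gt_eqF// mulr1.
have -> : x `^ (s - 1) = x `^ s / x.
  by rewrite powRB ?powRr1 ?ltW// (gt_eqF x0) implybT.
have := ler_wpM2l (powR_ge0 x s) (powR_bernoulli (divr_gt0 y0 x0) hs).
apply: le_trans; rewrite le_eqVlt; apply/orP; left; apply/eqP.
by field; rewrite gt_eqF.
Qed.

(** Heuristically [1 + n * x <= (1 + x) ^+ n] and [(1 - x) * (1 + x) <= 1]; the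
induction shortcuts the two steps. *)
Lemma expr_one_sub_mul_le1 (R : realType) (n : nat) (x : R) : 0 <= x -> x <= 1 ->
  (1 - x) ^+ n * (1 + n%:R * x) <= 1.
Proof.
move=> x0 x1; elim: n => [|n IH]; first by rewrite expr0; lra.
apply: le_trans IH; rewrite exprSr -mulrA ler_wpM2l ?exprn_ge0 ?subr_ge0//.
rewrite -natr1; have := ler0n R n; nra.
Qed.

Lemma ler_powR_neg (R : realType) (s x y : R) :
  s <= 0 -> 0 < x -> x <= y -> y `^ s <= x `^ s.
Proof.
move=> s0 x0 xy; have y0 := lt_le_trans x0 xy.
rewrite -[s]opprK 2!(powRN _ (- s)) lef_pV2 ?posrE ?powR_gt0//.
by rewrite ge0_ler_powR ?oppr_ge0 // ?nnegrE ltW.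
Qed.

Lemma powRK (R : realType) (s x : R) : 0 <= x -> s != 0 -> (x `^ s) `^ s^-1 = x.
Proof. by move=> x0 s0; rewrite -powRrM mulfV// powRr1. Qed.

Lemma powRVK (R : realType) (s x : R) : 0 <= x -> s != 0 -> (x `^ s^-1) `^ s = x.
Proof. by move=> x0 s0; rewrite -powRrM mulVf// powRr1. Qed.

(** * The mean of a vector with all entries but one equal to 1 *)

(** [symmetric_mean r] of the vector [(x, 1, ..., 1)] of length [n]. *)
Definition corner_mean (R : realType) n (r x : R) : R :=
  ((x `^ r + (n%:R - 1)) / n%:R) `^ r^-1.

(** Monotonicity of power means in the exponent, between [r] and [-1]: Jensen's
inequality for [y `^ (- r)] at the points [x^-1, 1, ..., 1], obtained by
summing the tangent inequalities at their arithmetic mean [mu]. *)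
Lemma corner_mean_le_harmonic (R : realType) n (r x : R) : (0 < n)%N ->
  r <= -1 -> 0 < x -> x <= 1 ->
  corner_mean n r x <= n%:R * x / (1 + (n%:R - 1) * x).
Proof.
move=> n0 r1 x0 x1; have N1 : 1 <= n%:R :> R by rewrite ler1n.
rewrite /corner_mean; set N : R := n%:R in N1 *.
have D0 : 0 < 1 + (N - 1) * x by nra.
pose mu := (1 + (N - 1) * x) / (N * x).
have mu0 : 0 < mu by rewrite divr_gt0//; nra.
have -> : N * x / (1 + (N - 1) * x) = (mu `^ (- r)) `^ r^-1.
  rewrite -powRrM mulNr mulfV ?lt_eqF//; last lra.
  by rewrite powR_inv1 ?ltW// /mu invf_div.
apply: ler_powR_neg; first by rewrite invr_le0; lra.
  exact: powR_gt0.
have s1 : - r <= 0 \/ 1 <= - r by right; lra.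
have := powR_tangent mu0 ltr01 s1.
have xV0 : 0 < x^-1 by rewrite invr_gt0.
have := powR_tangent mu0 xV0 s1.
rewrite powR1 -(powR_inv1 (ltW x0)) -powRrM mulN1r opprK (powR_inv1 (ltW x0)).
set A := mu `^ (- r); set B := - r * _; set C := x `^ r => h1 h2.
rewrite ler_pdivlMr; last lra.
have -> : A * N = A + B * (x^-1 - mu) + (N - 1) * (A + B * (1 - mu)).
  by rewrite /mu; field; rewrite !gt_eqF//; lra.
rewrite lerD// -[leRHS]mulr1 ler_wpM2l//; lra.
Qed.

(** For independent uniform variables on the unit interval: having all of them
above [x] is no likelier than having one of them above the mean of
[(x, 1, ..., 1)]. By monotonicity in [r] only the harmonic mean matters. *)
Lemma corner_mean_le_one_sub_exp (R : realType) n (r x : R) : (0 < n)%N ->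
  r <= -1 -> 0 < x -> x <= 1 -> corner_mean n r x <= 1 - (1 - x) ^+ n.
Proof.
move=> n0 r1 x0 x1; apply: le_trans (corner_mean_le_harmonic n0 r1 x0 x1) _.
case: n n0 => // n _; rewrite -natr1 addrK.
have D0 : 0 < 1 + n%:R * x by have := ler0n R n; nra.
rewrite ler_pdivrMr// exprS.
have := ler_wpM2l (_ : 0 <= 1 - x) (expr_one_sub_mul_le1 n (ltW x0) x1).
rewrite subr_ge0 => /(_ x1); nra.
Qed.

(** The relation [n * q `^ r = x `^ r + (n - 1)] between [x] and its mean [q] puts
a convex function on either side, so no derivative of [corner_mean] is needed. The tangent at [p] turns a drop of the mean into
a rise of its [r]-th power, and the tangent at [x] bounds that rise by the
step [y - x]. *)
Lemma corner_mean_drop (R : realType) n (r x y p : R) : (0 < n)%N ->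
  r <= -1 -> 0 < x -> x <= y -> p = corner_mean n r y ->
  p - p `^ (1 - r) * (y - x) * x `^ (r - 1) <= corner_mean n r x.
Proof.
move=> n0 r1; have rn0 : r != 0 by lra.
have hr : r <= 0 \/ 1 <= r by left; lra.
move=> x0 xy pE; have y0 := lt_le_trans x0 xy.
have N1 : 1 <= n%:R :> R by rewrite ler1n.
have pos z : 0 < z -> 0 < (z `^ r + (n%:R - 1)) / n%:R :> R.
  by move=> z0; rewrite divr_gt0//; [have := powR_gt0 r z0|]; lra.
have p0 : 0 < p by rewrite pE powR_gt0 ?pos.
have q0 : 0 < corner_mean n r x by rewrite powR_gt0 ?pos.
have := powR_tangent p0 q0 hr; have := powR_tangent x0 y0 hr.
have powr z : 0 < z -> corner_mean n r z `^ r = (z `^ r + (n%:R - 1)) / n%:R.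
  by move=> z0; rewrite powRVK// ltW// pos.
have Ep : p `^ r = (y `^ r + (n%:R - 1)) / n%:R by rewrite pE powr.
rewrite Ep (powr x x0); clear Ep powr pos pE; move: q0 p0.
set q := corner_mean n r x; clearbody q; move=> q0 p0.
set X := x `^ r; set Y := y `^ r; set N : R := n%:R in N1 *.
have -> : p `^ (1 - r) = (p `^ (r - 1))^-1 by rewrite -powRN opprB.
have := powR_gt0 (r - 1) p0; have := powR_gt0 (r - 1) x0.
set a := x `^ (r - 1); set b := p `^ (r - 1) => a0 b0 h1 h2.
(* The factor [1 / N] gained from averaging is given up here. *)
have h3 : (X + (N - 1)) / N - (Y + (N - 1)) / N <= X - Y.
  rewrite -mulrBl ler_pdivrMr; last lra.
  have XY : Y <= X by apply: ler_powR_neg => //; case: hr; lra.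
  have : 0 <= (X - Y) * (N - 1) by rewrite mulr_ge0// subr_ge0.
  lra.
have h4 : (- r) * (b * (p - q)) <= (- r) * (a * (y - x)) by lra.
have {}h4 : b * (p - q) <= a * (y - x) by rewrite ler_pM2l in h4; lra.
have : p - q <= a * (y - x) / b by rewrite ler_pdivlMr// mulrC.
have -> : b^-1 * (y - x) * a = a * (y - x) / b by ring.
lra.
Qed.

(** * Discrete uniform variables *)

(** The first [K] grid points carry mass [K / m]. With [K = m] this says that
[X] lives on the grid, and with smaller [K] it gives the tails of [X]. *)
Lemma uniform_grid (R : realType) (d : measure_display) (T : measurableType d)
    (P : probability T R) (m : nat) (X : {RV P >-> R}) :
  (0 < m)%N -> discrete_uniform m X ->
  forall K : nat, (K <= m)%N ->
  let G := [set w | exists2 k : nat, (1 <= k <= K)%N & X w = k%:R / m%:R] in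
  measurable G /\ P G = (K%:R / m%:R)%:E.
Proof.
move=> m0 unifX; elim=> [_|K IH Km] G.
  rewrite (_ : G = set0); first by rewrite measure0 mul0r; split.
  by rewrite -subset0 => w [k /andP[]]; case: k.
have [mG PG] := IH (ltnW Km).
set H := [set w | _] in mG PG.
have mX : measurable [set w | X w = K.+1%:R / m%:R].
  exact: (measurable_funPTI X (measurable_set1 _)).
have -> : G = H `|` [set w | X w = K.+1%:R / m%:R].
  apply/seteqP; split=> w /=.
    move=> [k /andP[k1]]; rewrite leq_eqVlt => /orP[/eqP ->|kK] Xk; first by right.
    by left; exists k => //; rewrite k1.
  move=> [[k /andP[k1 kK] Xk]|Xw]; last by exists K.+1 => //=; rewrite leqnn.
  by exists k => //; rewrite k1 leqW.
split; first exact: measurableU.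
transitivity (P H + P [set w | X w = (K.+1%:R / m%:R)%R])%E.
  apply: measureU => //; rewrite -subset0 => w /= [[k /andP[_ kK] ->]].
  have mV : (m%:R : R)^-1 != 0 by rewrite invr_eq0 pnatr_eq0 -lt0n.
  by move/(mulIf mV)/eqP; rewrite eqr_nat; move: kK => /[swap] /eqP ->; rewrite ltnn.
by rewrite PG unifX// -EFinD -{2}[m%:R^-1]mul1r -mulrDl natr1.
Qed.

(** Subtract from 1 the mass of the grid points that do not exceed [a]; rounding
[a] down to the grid costs at most one mesh [m%:R^-1]. *)
Lemma uniform_tail (R : realType) (d : measure_display) (T : measurableType d)
    (P : probability T R) (m : nat) (X : {RV P >-> R}) (a : R) :
  (0 < m)%N -> discrete_uniform m X -> 0 <= a -> a <= 1 ->
  (P [set w | (a < X w)%R] <= (1 - (a - m%:R^-1))%:E)%E.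
Proof.
move=> m0 unifX a0 a1.
have mR : 0 < m%:R :> R by rewrite ltr0n.
have am0 : 0 <= a * m%:R by rewrite mulr_ge0// ltW.
have /andP[Kle Kgt] := truncn_itv am0.
set K := Num.Def.trunc _ in Kle Kgt.
have Km : (K <= m)%N.
  by rewrite -(ler_nat R); apply: le_trans Kle _; rewrite ler_piMl// ltW.
have [mG PG] := uniform_grid m0 unifX Km; set G := [set w | _] in mG PG.
apply: (@le_trans _ _ (P (~` G))).
  apply: le_measure; rewrite ?inE.
  - rewrite (_ : [set w | _] = X @^-1` `]a, +oo[%classic).
      exact: (measurable_funPTI X (measurable_itv _)).
    by apply/seteqP; split=> w /=; rewrite in_itv/= andbT.
  - exact: measurableC.
  - move=> w /= aX [k /andP[_ kK] Xk]; move: aX.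
    rewrite Xk ltr_pdivlMr// ltNge => /negP; apply.
    by apply: le_trans Kle; rewrite ler_nat.
rewrite probability_setC// PG -EFinB lee_fin lerD2l lerN2 lerBlDr.
by rewrite -{2}[m%:R^-1]mul1r -mulrDl natr1 ler_pdivlMr// ltW.
Qed.

(** Only almost everywhere: the law of [X] leaves its values on a null set free,
and the mean could misbehave there. *)
Lemma uniform_ae01 (R : realType) (d : measure_display) (T : measurableType d)
    (P : probability T R) (m : nat) (X : {RV P >-> R}) :
  (0 < m)%N -> discrete_uniform m X -> {ae P, forall w, 0 < X w <= 1}.
Proof.
move=> m0 unifX; have [mG PG] := uniform_grid m0 unifX (leqnn m).
set G := [set w | _] in mG PG.
have mR : 0 < m%:R :> R by rewrite ltr0n.
exists (~` G); split; first exact: measurableC.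
  by rewrite probability_setC// PG divff ?gt_eqF// subee.
move=> w /= H [k /andP[k1 km] Xk]; apply: H; rewrite Xk.
by rewrite divr_gt0 ?ltr0n// ler_pdivrMr// mul1r ler_nat.
Qed.

Lemma measurable_symmetric_mean (R : realType) (d : measure_display)
    (T : measurableType d) (P : probability T R) (n : nat) (r p : R)
    (X : 'I_n -> {RV P >-> R}) :
  measurable [set w | symmetric_mean r (fun i => X i w) <= p].
Proof.
have mM : measurable_fun setT (fun w => symmetric_mean r (fun i => X i w)).
  rewrite /symmetric_mean; apply: (measurableT_comp (measurable_powR _)).
  apply: measurable_funM => //; apply: measurable_sum => i.
  by apply: (measurableT_comp (measurable_powR _)).
rewrite -[X in measurable X]setTI.
rewrite (_ : [set w | _] =
  (fun w => symmetric_mean r (fun i => X i w)) @^-1` `]-oo, p]%classic).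
  exact: (mM measurableT _ (measurable_itv _)).
by apply/seteqP; split=> w /=; rewrite in_itv.
Qed.

(** * The orthant that contains the event of a large mean *)

(** The [x] for which the vector [(x, 1, ..., 1)] has mean exactly [p]. *)
Definition box_edge (R : realType) (n : nat) (r p : R) : R :=
  (n%:R * p `^ r - (n%:R - 1)) `^ r^-1.

Lemma box_edge_base_ge1 (R : realType) (n : nat) (r p : R) :
  r <= -1 -> 0 < p -> p < 1 -> 1 <= n%:R * p `^ r - (n%:R - 1).
Proof.
move=> r1 p0 p1.
have r0 : r <= 0 by lra.
have := ler_powR_neg r0 p0 (ltW p1); rewrite powR1 => pr1.
by have := ler_wpM2l (ler0n R n) pr1; lra.
Qed.

Lemma box_edge_le1 (R : realType) (n : nat) (r p : R) :
  r <= -1 -> 0 < p -> p < 1 -> box_edge n r p <= 1.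
Proof.
move=> r1 p0 p1.
have r0 : r <= 0 by lra.
have V0 : r^-1 <= 0 by rewrite invr_le0.
have := ler_powR_neg V0 ltr01 (box_edge_base_ge1 n r1 p0 p1).
by rewrite powR1.
Qed.

Lemma corner_mean_box_edge (R : realType) (n : nat) (r p : R) : (0 < n)%N ->
  r <= -1 -> 0 < p -> p < 1 -> corner_mean n r (box_edge n r p) = p.
Proof.
move=> n0 r1 p0 p1.
have rn0 : r != 0 by lra.
have N1 : 1 <= n%:R :> R by rewrite ler1n.
have c0 : 0 <= n%:R * p `^ r - (n%:R - 1).
  exact: (le_trans _ (box_edge_base_ge1 n r1 p0 p1)).
rewrite /corner_mean /box_edge powRVK// subrK mulrC mulKf ?powRK ?(ltW p0)//.
by rewrite gt_eqF// (lt_le_trans ltr01).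
Qed.

(** The entries other than [u i] contribute at least [1] each to the sum of the
[r]-th powers, because [r] is negative and they are at most [1]. *)
Lemma coord_gt_of_mean_gt (R : realType) (n : nat) (r p : R) (u : 'I_n -> R)
    (i : 'I_n) : r <= -1 -> 0 < p -> p < 1 ->
  (forall j, 0 < u j <= 1) -> p < symmetric_mean r u -> box_edge n r p < u i.
Proof.
move=> r1 p0 p1 u01 pM.
have c0 : 0 < n%:R * p `^ r - (n%:R - 1).
  exact: lt_le_trans ltr01 (box_edge_base_ge1 n r1 p0 p1).
have [ui0 _] := andP (u01 i).
have n0 : 0 < n%:R :> R by rewrite ltr0n (leq_ltn_trans _ (ltn_ord i)).
have rn0 : r != 0 by lra.
have r0 : r <= 0 by lra.
rewrite ltNge; apply/negP => ui; move: pM; rewrite ltNge => /negP; apply.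
rewrite -(powRK (ltW p0) rn0) /symmetric_mean.
apply: ler_powR_neg; [by rewrite invr_le0|exact: powR_gt0|].
rewrite ler_pdivlMr// mulrC.
have := ler_powR_neg r0 ui0 ui.
rewrite powRVK ?(ltW c0)// (bigD1 i)//= => h.
suff : n%:R - 1 <= \sum_(j < n | j != i) u j `^ r by lra.
rewrite (_ : n%:R - 1 = \sum_(j < n | j != i) (1 : R)); last first.
  (* The index [i] witnesses [0 < n], so [n.-1] does not truncate. *)
  rewrite sumr_const cardC1 card_ord; move: n0; rewrite ltr0n.
  by move: (n) => [//|k] _; rewrite -natr1 addrK.
apply: ler_sum => j _; have /andP[uj0 uj1] := u01 j.
by have := ler_powR_neg r0 uj0 uj1; rewrite powR1.
Qed.

(** Outside a null set, a mean above [p] puts all coordinates above [box_edge],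
an event to which negative upper orthant dependence applies. *)
Lemma mean_le_prob_ge (R : realType) (d : measure_display)
    (T : measurableType d) (P : probability T R) (n m : nat) (r p : R)
    (X : 'I_n -> {RV P >-> R}) :
  (0 < m)%N -> (forall i, discrete_uniform m (X i)) -> NUOD X ->
  r <= -1 -> 0 < p -> p < 1 ->
  ((1 - (1 - (box_edge n r p - m%:R^-1)) ^+ n)%:E <=
    P [set w | (symmetric_mean r (fun i => X i w) <= p)%R])%E.
Proof.
move=> m0 unifX nuodX r1 p0 p1; set a := box_edge n r p.
have a1 : a <= 1 := box_edge_le1 n r1 p0 p1.
have mE := measurable_symmetric_mean r p X; set E := [set w | _] in mE *.
have mtail i : measurable [set w | a < X i w].
  rewrite (_ : [set w | _] = X i @^-1` `]a, +oo[%classic).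
    exact: (measurable_funPTI (X i) (measurable_itv _)).
  by apply/seteqP; split=> w /=; rewrite in_itv/= andbT.
pose B := [set w | forall i, a < X i w].
have mB : measurable B.
  rewrite (_ : B = \bigcap_(i in [set: 'I_n]) [set w | a < X i w]).
    by apply: fin_bigcap_measurable => // i _; exact: mtail.
  by apply/seteqP; split=> w /= H i; [move=> _|]; exact: H.
have PB : (P B <= ((1 - (a - m%:R^-1)) ^+ n)%:E)%E.
  apply: le_trans (nuodX (fun=> a)) _.
  have -> : ((1 - (a - m%:R^-1)) ^+ n)%:E =
      (\prod_(i < n) (1 - (a - m%:R^-1))%:E)%E :> \bar R.
    by rewrite prodEFin prodr_const card_ord.
  suff /andP[] : ((0 <= \prod_(i < n) P [set w | (a < X i w)%R]) &&
    (\prod_(i < n) P [set w | (a < X i w)%R] <=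
      \prod_(i < n) (1 - (a - m%:R^-1))%:E))%E by [].
  elim/big_ind2 : _ => [|x1 x2 y1 y2 /andP[h1 h2] /andP[h3 h4]|i _].
  - by rewrite lee01 lexx.
  - by rewrite mule_ge0// lee_pmul.
  - by rewrite measure_ge0/= uniform_tail// powR_ge0.
have [N [mN PN0 subN]] : {ae P, forall w, forall i, 0 < X i w <= 1}.
  by apply: filter_forall => i; exact: (uniform_ae01 m0 (unifX i)).
have PEc : (P (~` E) <= P B)%E.
  rewrite -(measureU0 mB mN PN0); apply: le_measure; rewrite ?inE.
  - exact: measurableC.
  - exact: measurableU.
  move=> w /= /negP; rewrite -ltNge => pM.
  have [u01|Nu] := pselect (forall i, 0 < X i w <= 1); last by right; exact: subN.
  by left => i; apply: (coord_gt_of_mean_gt i r1 p0 p1 u01 pM).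
have := le_trans PEc PB; rewrite probability_setC//.
have : P E \is a fin_num by exact: fin_num_measure.
by move/fineK <-; rewrite -EFinB !lee_fin lerBlDl lerBlDr addrC.
Qed.

(** * The explicit lower bound *)

(** The analogue of [box_edge] for the vector with [(m + 1) / m] in place of the
entries equal to 1. *)
Definition rounded_edge (R : realType) (n m : nat) (r p : R) : R :=
  (n%:R * p `^ r - (n%:R - 1) * ((m%:R + 1) / m%:R) `^ r) `^ r^-1.

(** The upper bound compares with the orthant; the lower bound is uniform in [m]
and keeps the error term of the sequence bounded by a multiple of [1 / m]. *)
Lemma rounded_edge_bounds (R : realType) (n m : nat) (r p : R) :
  (0 < n)%N -> (0 < m)%N -> r <= -1 -> 0 < p -> p < 1 ->
  n%:R `^ r^-1 * p <= rounded_edge n m r p <= box_edge n r p.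
Proof.
move=> n0 m0 r1 p0 p1.
have r0 : r <= 0 by lra.
have rn0 : r != 0 by lra.
have N1 : 1 <= n%:R :> R by rewrite ler1n.
have q0 := powR_ge0 ((m%:R + 1) / m%:R : R) r.
have q1 : ((m%:R + 1) / m%:R) `^ r <= 1 :> R.
  have m1 : 1 <= (m%:R + 1) / m%:R :> R.
    by rewrite ler_pdivlMr ?ltr0n// mul1r lerDl.
  by have := ler_powR_neg r0 ltr01 m1; rewrite powR1.
have c1 := box_edge_base_ge1 n r1 p0 p1.
have Nq : 0 <= (n%:R - 1) * ((m%:R + 1) / m%:R) `^ r :> R.
  by rewrite mulr_ge0// subr_ge0.
have Nq1 : (n%:R - 1) * ((m%:R + 1) / m%:R) `^ r <= n%:R - 1 :> R.
  by rewrite ler_piMr// subr_ge0.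
rewrite /rounded_edge /box_edge; apply/andP; split; last first.
  by apply: ler_powR_neg; rewrite ?invr_le0//; lra.
rewrite -{1}(powRK (ltW p0) rn0) -powRM ?ler0n ?powR_ge0//.
by apply: ler_powR_neg; rewrite ?invr_le0//; lra.
Qed.

(** In this form the threshold on [m], with the lower bound on [rounded_edge],
ensures that [rounded_edge - m%:R^-1] is positive. *)
Lemma lower_bound_seq_cond (R : realType) (n m : nat) (r p : R) :
  (0 < n)%N -> (0 < m)%N -> 0 < p ->
  (n%:R `^ (- r^-1) * p^-1 < m%:R) =
  (m%:R^-1 < n%:R `^ r^-1 * p).
Proof.
move=> n0 m0 p0.
have b0 : 0 < n%:R `^ r^-1 * p by rewrite mulr_gt0// powR_gt0// ltr0n.
have mV0 : 0 < m%:R^-1 :> R by rewrite invr_gt0 ltr0n.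
by rewrite powRN -invfM -(ltf_pV2 b0 mV0) invrK.
Qed.

Lemma lower_bound_seqE (R : realType) (n m : nat) (r p : R) :
  (0 < n)%N -> (0 < m)%N -> 0 < p -> m%:R^-1 < n%:R `^ r^-1 * p ->
  lower_bound_seq n r p m =
  p - p `^ (1 - r) / m%:R * (rounded_edge n m r p - m%:R^-1) `^ (r - 1).
Proof.
by move=> n0 m0 p0 H; rewrite /lower_bound_seq (lower_bound_seq_cond _ n0 m0 p0) H.
Qed.

Lemma lower_bound_seq_le_corner_mean (R : realType) (n m : nat) (r p : R) :
  (0 < n)%N -> (0 < m)%N -> r <= -1 -> 0 < p -> p < 1 -> m%:R^-1 < n%:R `^ r^-1 * p ->
  lower_bound_seq n r p m <= corner_mean n r (box_edge n r p - m%:R^-1).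
Proof.
move=> n0 m0 r1 p0 p1.
have r0 : r <= 0 by lra.
move=> H; rewrite (lower_bound_seqE n0 m0 p0 H).
have /andP[lb ub] := rounded_edge_bounds n0 m0 r1 p0 p1.
have mV0 : 0 < m%:R^-1 :> R by rewrite invr_gt0 ltr0n.
have x0 : 0 < rounded_edge n m r p - m%:R^-1 by lra.
have xe : rounded_edge n m r p - m%:R^-1 <= box_edge n r p - m%:R^-1 by rewrite lerD2r.
have y0 := lt_le_trans x0 xe.
have ye : box_edge n r p - m%:R^-1 <= box_edge n r p by rewrite gerBl ltW.
apply: le_trans (corner_mean_drop n0 r1 y0 ye (esym (corner_mean_box_edge n0 r1 p0 p1))).
rewrite subKr lerD2l lerN2 ler_wpM2l//.
  by rewrite mulr_ge0 ?powR_ge0// ltW.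
by apply: ler_powR_neg => //; lra.
Qed.

Lemma lower_bound_seq_le_prob (R : realType) (d : measure_display)
    (T : measurableType d) (P : probability T R) (n m : nat) (r p : R)
    (X : 'I_n -> {RV P >-> R}) :
  (0 < n)%N -> (0 < m)%N -> r <= -1 -> 0 < p -> p < 1 ->
  (forall i, discrete_uniform m (X i)) -> NUOD X ->
  ((lower_bound_seq n r p m)%:E <=
    P [set w | (symmetric_mean r (fun i => X i w) <= p)%R])%E.
Proof.
move=> n0 m0 r1 p0 p1 unifX nuodX.
have [mbig|msmall] := boolP (n%:R `^ (- r^-1) * p^-1 < m%:R); last first.
  by rewrite /lower_bound_seq (negbTE msmall) measure_ge0.
rewrite lower_bound_seq_cond// in mbig.
have a1 := box_edge_le1 n r1 p0 p1.
apply: le_trans (mean_le_prob_ge m0 unifX nuodX r1 p0 p1).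
rewrite lee_fin; apply: le_trans (lower_bound_seq_le_corner_mean n0 m0 r1 p0 p1 mbig) _.
have /andP[lb ub] := rounded_edge_bounds n0 m0 r1 p0 p1.
have mV0 : 0 < m%:R^-1 :> R by rewrite invr_gt0 ltr0n.
by apply: corner_mean_le_one_sub_exp => //; lra.
Qed.

Lemma lower_bound_seq_cvg (R : realType) (n : nat) (r p : R) :
  (0 < n)%N -> r <= -1 -> 0 < p -> p < 1 -> lower_bound_seq n r p @ \oo --> p.
Proof.
move=> n0 r1 p0 p1.
pose b : R := n%:R `^ r^-1 * p.
have b0 : 0 < b by rewrite mulr_gt0// powR_gt0// ltr0n.
pose C : R := p `^ (1 - r) * (b / 2) `^ (r - 1).
have C0 : 0 <= C by rewrite mulr_ge0// powR_ge0.
apply: (@squeeze_cvgr _ _ _ _ (fun m => p - 2 * C * harmonic m) (fun=> p)).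
- near=> m.
  (* Beyond [2 / b] the base of the power in the error term exceeds [b / 2]. *)
  have m0 : (0 < m)%N by near: m; exact: nbhs_infty_ge.
  have mR : 0 < m%:R :> R by rewrite ltr0n.
  have mb : m%:R^-1 < b / 2.
    rewrite -ltf_pV2 ?posrE ?invr_gt0// ?divr_gt0// invrK.
    by near: m; exact: nbhs_infty_gtr.
  have mV0 : 0 < m%:R^-1 :> R by rewrite invr_gt0.
  have H : m%:R^-1 < n%:R `^ r^-1 * p by rewrite -/b; lra.
  rewrite (lower_bound_seqE n0 m0 p0 H).
  have /andP[lb _] := rounded_edge_bounds n0 m0 r1 p0 p1.
  set e := p `^ (1 - r) / m%:R * _.
  have e0 : 0 <= e by rewrite mulr_ge0 ?powR_ge0// mulr_ge0 ?powR_ge0// ltW.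
  apply/andP; split; last by rewrite gerBl.
  rewrite lerD2l lerN2; apply: (@le_trans _ _ (C * m%:R^-1)).
    rewrite /e /C mulrAC ler_wpM2r ?(ltW mV0)// ler_wpM2l ?powR_ge0//.
    by apply: ler_powR_neg; [lra|rewrite divr_gt0|rewrite -/b in lb; lra].
  have m1 : 1 <= m%:R :> R by rewrite ler1n.
  (* The harmonic sequence is [m.+1^-1], hence the factor 2. *)
  have mV : m%:R^-1 <= 2 * harmonic m :> R.
    by rewrite /harmonic/= ler_pdivlMr// ler_pdivrMl// -natr1; lra.
  by rewrite -mulrA mulrCA ler_wpM2l.
- rewrite -[X in _ --> X]subr0 -[X in _ - X](mulr0 (2 * C)).
  by apply: cvgB; [exact: cvg_cst|apply: cvgMr; exact: cvg_harmonic].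
- exact: cvg_cst.
Unshelve. all: by end_near. Qed.

Theorem theorem3 (R : realType) (n : nat) (r p : R)
    (d : nat -> measure_display) (T : forall m : nat, measurableType (d m))
    (P : forall m : nat, probability (T m) R)
    (U : forall m : nat, 'I_n -> {RV (P m) >-> R}) :
  (2 <= n)%N -> r <= -1 -> 0 < p -> p < 1 ->
  (forall m : nat, (2 <= m)%N ->
     (forall i : 'I_n, discrete_uniform m (U m i)) /\ NUOD (U m)) ->
  (exists q : nat -> R,
     (forall m : nat, (2 <= m)%N ->
        ((q m)%:E <=
         P m [set w | (symmetric_mean r (fun i => U m i w) <= p)%R])%E) /\
     q @ \oo --> p) /\
  ((forall m : nat, (2 <= m)%N ->
      ((lower_bound_seq n r p m)%:E <=
       P m [set w | (symmetric_mean r (fun i => U m i w) <= p)%R])%E) /\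
   lower_bound_seq n r p @ \oo --> p).
Proof.
move=> n2 r1 p0 p1 hU.
have n0 : (0 < n)%N by exact: ltnW.
have lb m : (2 <= m)%N -> ((lower_bound_seq n r p m)%:E <=
    P m [set w | (symmetric_mean r (fun i => U m i w) <= p)%R])%E.
  move=> m2; have [unifU nuodU] := hU m m2.
  exact: lower_bound_seq_le_prob (ltnW m2) r1 p0 p1 unifU nuodU.
have cvg := lower_bound_seq_cvg n0 r1 p0 p1.
by split; [exists (lower_bound_seq n r p)|].
Qed.
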